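(* Let $n\ge 1$. The monomials $\mathsf{S}^u$, where $u$ runs over the set of $U$-sets (subsets of $[n]\sqcup\Phi_{>1}$ as defined in the context), form a basis of $\mathbf{M}^*(n)$ as an abelian group (i.e. a $\mathbb{Z}$-basis).
   Context: Roots. Fix an integer $n\ge1$, $[n]=\{1,\dots,n\}$. For $1\le i\le j\le n$ let $[i,j]=\{i,i+1,\dots,j\}$. $\Phi_{>0}$ is the set of all intervals $[i,j]$ in $[n]$; $\Phi_{>1}$ is the subset of those with $i<j$. Two intervals $[i,j]$ and $[k,\ell]$ overlap if $i\le k\le j\le\ell$ or $k\le i\le\ell\le j$. The ring $\mathbf{M}^*(n)$. It is the commutative ring (over $\mathbb{Z}$) generated by variables $\mathsf{S}_i$ ($i\in[n]$) and $\mathsf{S}_\alpha$ ($\alpha\in\Phi_{>1}$; also written $\mathsf{S}_{i,j}$ if $\alpha=[i,j]$) modulo the relations: (1) $\mathsf{S}_i^2=0$ for $i\in[n]$; (2) $\mathsf{S}_i\mathsf{S}_\alpha=\sum_{j\in\alpha,\,j\ne i}\mathsf{S}_i\mathsf{S}_j$ for $i\in\alpha\in\Phi_{>1}$; (3) for all $\alpha=[a,b]$ and $\beta=[c,d]$ in $\Phi_{>1}$ (possibly equal) with $a\le c\le b\le d$ and $\#(\alpha\cap\beta)\ge2$, $$\mathsf{S}_\alpha\mathsf{S}_\beta=\sum_{i<j,\ i,j\in\alpha\cap\beta}\mathsf{S}_i\mathsf{S}_j+\sum_{\ell\in I}\mathsf{S}_{a,\ell}\,\mathsf{S}_{\ell,d}-\sum_{\ell,\,\ell+1\in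 I}\mathsf{S}_{a,\ell}\,\mathsf{S}_{\ell+1,d},$$ where $I=(\alpha\setminus\{a\})\cap(\beta\setminus\{d\})$. It is graded with all generators in degree $1$. $U$-sets. A $U$-set is a subset $u$ of $[n]\sqcup\Phi_{>1}$ such that (i) if $i\in u$ ($i\in[n]$) and $\alpha\in u$ ($\alpha\in\Phi_{>1}$), then $i\notin\alpha$; (ii) if two distinct $\alpha,\beta\in u\cap\Phi_{>1}$ overlap, then $\alpha\cap\beta$ is a singleton. For a $U$-set $u$, $\mathsf{S}^u\in\mathbf{M}^*(n)$ is the product of the variables $\mathsf{S}_i$ and $\mathsf{S}_\alpha$ over the elements $i,\alpha$ of $u$. *)

(* Defs.v *)
From HB Require Import structures.
From mathcomp Require Import all_boot all_order all_algebra.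
From mathcomp Require Import boolp.
From mathcomp.multinomials Require Import mpoly.

Set Implicit Arguments.
Unset Strict Implicit.
Unset Printing Implicit Defensive.

Import GRing.Theory.
Local Open Scope ring_scope.
Local Open Scope quotient_scope.

(* [n] is represented by 'I_n, so the indices are shifted to start at 0. *)

(* An interval [i,j] with i < j is represented by its pair of endpoints. *)
Definition Phi1 (n : nat) := {p : 'I_n * 'I_n | (p.1 < p.2)%N}.

Section Intervals.
Variable n : nat.
Implicit Types a b : Phi1 n.

Definition lo a : 'I_n := (val a).1.
Definition hi a : 'I_n := (val a).2.

Definition itv a : {set 'I_n} := [set i : 'I_n | (lo a <= i <= hi a)%N].

Definition overlap a b : bool :=
  [&& (lo a <= lo b)%N, (lo b <= hi a)%N & (hi a <= hi b)%N]
  || [&& (lo b <= lo a)%N, (lo a <= hi b)%N & (hi b <= hi a)%N].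

End Intervals.

(* Index type of the generators of M^*(n): the disjoint union of [n] and of
   Phi_{>1}. *)
Definition gen (n : nat) : finType := ('I_n + Phi1 n)%type.

Section Presentation.
Variable n : nat.

Definition freeM := {mpoly int[#|{: gen n}|]}.

Definition var (g : gen n) : freeM := 'X_(enum_rank g).

Definition S_ (i : 'I_n) : freeM := var (inl i).
Definition SI (a : Phi1 n) : freeM := var (inr a).

(* S_{i,j}, with the irrelevant value 0 when i < j fails; in the third family
   of relations below it is only used for i < j. *)
Definition Sij (i j : 'I_n) : freeM :=
  if insub (i, j) is Some a then SI a else 0.

(* The elements "left-hand side minus right-hand side". *)
Definition rel1 (i : 'I_n) : freeM := S_ i ^+ 2.

Definition rel2 (i : 'I_n) (a : Phi1 n) : freeM :=
  S_ i * SI a - \sum_(j in itv a | j != i) S_ i * S_ j.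

Definition rel3 (a b : Phi1 n) : freeM :=
  let AB := itv a :&: itv b in
  let I := (itv a :\ lo a) :&: (itv b :\ hi b) in
  SI a * SI b -
  (\sum_(i in AB) \sum_(j in AB | (i < j)%N) S_ i * S_ j
   + \sum_(l in I) Sij (lo a) l * Sij l (hi b)
   - \sum_(l in I) \sum_(m in I | m == l.+1 :> nat)
       Sij (lo a) l * Sij m (hi b)).

Inductive relM : freeM -> Prop :=
| RelM1 i : relM (rel1 i)
| RelM2 i a of i \in itv a : relM (rel2 i a)
| RelM3 a b of (lo a <= lo b)%N & (lo b <= hi a)%N & (hi a <= hi b)%N
    & (2 <= #|itv a :&: itv b|)%N : relM (rel3 a b).

End Presentation.

Inductive gen_ideal (R : comNzRingType) (X : R -> Prop) : R -> Prop :=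
| GenIdeal0 : gen_ideal X 0
| GenIdealD r x y of X x & gen_ideal X y : gen_ideal X (r * x + y).

Lemma gen_ideal_comb (R : comNzRingType) (X : R -> Prop) r x y :
  gen_ideal X x -> gen_ideal X y -> gen_ideal X (r * x + y).
Proof.
move=> Xx Xy; elim: Xx => [|s z t Xz _ IH]; first by rewrite mulr0 add0r.
by rewrite mulrDr mulrA -addrA; apply: GenIdealD.
Qed.

Definition idealM (n : nat) : {pred freeM n} :=
  fun p => `[< gen_ideal (@relM n) p >].

Lemma var_eval0 n (g : gen n) : (var g).@[fun=> 0] = 0.
Proof. by rewrite /var mevalXU. Qed.

Lemma Sij_eval0 n (i j : 'I_n) : (Sij i j).@[fun=> 0] = 0.
Proof. by rewrite /Sij; case: insubP => [a _ _|_]; rewrite ?var_eval0 ?raddf0. Qed.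

Lemma sum_eval0 n (J : finType) (P : pred J) (F : J -> freeM n) :
  (forall j, P j -> (F j).@[fun=> 0] = 0) ->
  (\sum_(j | P j) F j).@[fun=> 0] = 0.
Proof.
move=> F0; elim/big_ind: _ => // [|p q p0 q0]; first exact: meval0.
by rewrite mevalD p0 q0 addr0.
Qed.

Lemma relM_eval0 n (p : freeM n) : relM p -> p.@[fun=> 0] = 0.
Proof.
case=> [i|i a _|a b _ _ _ _].
- by rewrite /rel1 expr2 mevalM var_eval0 mul0r.
- rewrite /rel2 mevalB mevalM var_eval0 mul0r sum_eval0 ?subr0 // => j _.
  by rewrite mevalM var_eval0 mul0r.
rewrite /rel3 /= mevalB mevalM var_eval0 mul0r mevalB mevalD.
rewrite !sum_eval0 ?addr0 ?subr0 // => l _; rewrite ?sum_eval0 // => *;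
  by rewrite mevalM ?Sij_eval0 ?var_eval0 mul0r.
Qed.

Lemma idealM_closed n : idealr_closed (@idealM n).
Proof.
split; first by apply/asboolP; apply: GenIdeal0.
  apply/negP => /asboolP H.
  have E (p : freeM n) : gen_ideal (@relM n) p -> p.@[fun=> 0] = 0.
    elim=> [|r x y /relM_eval0 x0 _ y0]; first by rewrite raddf0.
    by rewrite rmorphD rmorphM /= x0 y0 mulr0 addr0.
  by have := E _ H; rewrite rmorph1 => /eqP; rewrite oner_eq0.
move=> r x y /asboolP Xx /asboolP Xy; apply/asboolP; exact: gen_ideal_comb.
Qed.

HB.instance Definition _ n := isIdealr.Build (freeM n) (@idealM n)
  (@idealM_closed n).

(* The ring M^*(n). *)
Definition M (n : nat) := {ideal_quot (@idealM n)}.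
HB.instance Definition _ n := GRing.ComNzRing.on (M n).
HB.instance Definition _ n := EqQuotient.on (M n).

Definition Mgen n (g : gen n) : M n := \pi_(M n) (var g).

Definition is_Uset n (u : {set gen n}) : bool :=
  [forall i : 'I_n, forall a : Phi1 n,
     (inl i \in u) && (inr a \in u) ==> (i \notin itv a)]
  && [forall a : Phi1 n, forall b : Phi1 n,
     [&& inr a \in u, inr b \in u, a != b & overlap a b]
       ==> (#|itv a :&: itv b| == 1%N)].

Definition Uset (n : nat) : finType := {u : {set gen n} | is_Uset u}.

Definition Smon n (u : Uset n) : M n := \prod_(g in val u) Mgen g.

Definition is_Zbasis (V : zmodType) (J : finType) (e : J -> V) : Prop :=
  (forall v : V, exists c : J -> int, v = \sum_(j : J) e j *~ c j) /\
  (forall c : J -> int, \sum_(j : J) e j *~ c j = 0 -> forall j, c j = 0).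

(* Main.v *)
Require Import Defs.
From mathcomp Require Import all_boot all_order all_algebra.
From HB Require Import structures.
From mathcomp Require Import ring zify.
From mathcomp.multinomials Require Import mpoly.
Set Implicit Arguments.
Unset Strict Implicit.
Unset Printing Implicit Defensive.
Import GRing.Theory.
Local Open Scope ring_scope.

(* Spanning: each relation rewrites a product of two generators that cannot
   occur together in a U-set into products of smaller total length.

   Independence: put E_i = S_i and E_[a,b] = S_a + ... + S_b - S_[a,b].  The
   relations become E_i E_[a,b] = 0 for i in [a,b] and
     (E_[a,b] - E_[a,l]) (E_[l,d] - E_[l+1,d]) = 0   for a <= l < b <= d.
   Deform the first family to (E_i - x_i) E_[a,b] = 0, with x_i = N (i + 1) for
   an integer N <> 0.  The deformed relations have one integer solution for each
   U-set u: E_[a,b] = 0 unless [a,b] is covered by u, and otherwise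
   E_[a,b] = x_m where m is the root of the interval [a,b] in a binary search
   tree built from u.  These solutions are pairwise distinct, so interpolation
   shows that the matrix of the values of the monomials S^u at them is
   nonsingular.  Modulo N the deformation is trivial, so the coefficients of a
   linear relation between the S^u in M^*(n) are divisible by N.  As N is
   arbitrary, they vanish. *)

(** * Integer points attached to U-sets *)

Section Points.
Variables (n : nat) (u : {set gen n}).

Definition supp (k : nat) : bool :=
  [exists i : 'I_n, (i == k :> nat) &&
     ((inl i \in u) || [exists a : Phi1 n, (inr a \in u) && (i \in itv a)])].

Definition full (a b : nat) : bool := [forall k : 'I_n, (a <= k <= b)%N ==> supp k].

(* In the tree attached to u, the right subtree of the node a extends up to the
   largest b such that reach a b. *)
Definition reach (a b : nat) : bool :=
  [forall k : 'I_n, (a <= k < b)%N ==>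
    [exists al : Phi1 n, [&& inr al \in u, (a <= lo al)%N, (lo al <= k)%N & (k < hi al)%N]]].

Lemma reachP (a b : nat) :
  reflect (forall k : 'I_n, (a <= k < b)%N -> exists al : Phi1 n,
             [&& inr al \in u, (a <= lo al)%N, (lo al <= k)%N & (k < hi al)%N])
          (reach a b).
Proof.
apply: (iffP forallP) => h k; first by move=> hk; have /existsP := implyP (h k) hk.
by apply/implyP => hk; apply/existsP; apply: h.
Qed.

Lemma reach_refl b : reach b b.
Proof. by apply/reachP => k; lia. Qed.

Lemma reach_le a b c : (c <= b)%N -> reach a b -> reach a c.
Proof. by move=> cb /reachP h; apply/reachP => k hk; apply: h; lia. Qed.

Lemma reach_trans a l b : (a <= l)%N -> reach a l -> reach l b -> reach a b.
Proof.
move=> al /reachP h1 /reachP h2; apply/reachP => k hk.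
have [kl|lk] := ltnP k l; first by apply: h1; lia.
have [|be] := h2 k; first by lia.
by case/and4P=> *; exists be; apply/and4P; split=> //; lia.
Qed.

Variable x : nat -> int.

(* topval a b = x m, where m is the least element >= a such that reach m b. *)
Fixpoint topval_rec (b d : nat) : int :=
  if d is d'.+1 then
    if reach (b - d) b then x (b - d) else topval_rec b d'
  else x b.

Definition topval (a b : nat) : int := topval_rec b (b - a).

Lemma topval_refl b : topval b b = x b.
Proof. by rewrite /topval subnn. Qed.

Lemma topvalS a b : (a < b)%N ->
  topval a b = if reach a b then x a else topval a.+1 b.
Proof.
move=> ab; rewrite /topval; have -> : (b - a = (b - a.+1).+1)%N by lia.
rewrite /=; have -> // : (b - (b - a.+1).+1 = a)%N by lia.
Qed.

Lemma topval_reach a b : (a <= b)%N -> reach a b -> topval a b = x a.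
Proof.
rewrite leq_eqVlt => /orP[/eqP <- _|ab rab]; first exact: topval_refl.
by rewrite topvalS // rab.
Qed.

(** Since [l] reaches [b], a point below [l] reaches [b] exactly when it reaches [l]. The two
    searches starting at [a] make the same choices and both stop at [l] at the latest. *)
Lemma topval_stable a l b : (a <= l <= b)%N -> reach l b -> topval a b = topval a l.
Proof.
move=> /andP[al lb] rlb; have [d dE] : exists d, d = (l - a)%N by exists (l - a)%N.
elim: d a al dE => [|d IH] a al dE.
  have -> : a = l by lia.
  by rewrite topval_refl topval_reach.
rewrite (@topvalS a b) 1?(@topvalS a l); try lia.
have -> : reach a b = reach a l.
  by apply/idP/idP => [|r]; [exact: reach_le | exact: (reach_trans _ r)].
by case: ifP => // _; apply: IH; lia.
Qed.

Lemma topval_mem a b : (a <= b)%N -> exists2 i, (a <= i <= b)%N & topval a b = x i.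
Proof.
move=> ab; have [d dE] : exists d, d = (b - a)%N by exists (b - a)%N.
elim: d a ab dE => [|d IH] a ab dE.
  by exists b; [lia | rewrite -topval_refl; congr topval; lia].
rewrite topvalS; last lia.
case: ifP => _; first by exists a => //; lia.
by have [||i hi ->] := IH a.+1; [lia..|exists i => //; lia].
Qed.

Definition ptval (a b : nat) : int := if full a b then topval a b else 0.

(** If [[a,b]] is covered then so is [i], and [E_i = x_i]; otherwise [E_[a,b] = 0]. *)
Lemma ptval_sing i a b : (a <= i <= b)%N ->
  ptval i i * ptval a b = x i * ptval a b.
Proof.
move=> hi; rewrite {2 3}/ptval; case: ifP => [/forallP f|_]; last by rewrite !mulr0.
rewrite /ptval ifT ?topval_refl //; apply/forallP => k; apply/implyP => hk.
by apply: (implyP (f k)); lia.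
Qed.

(** If [[l,d]] is covered and [l] does not reach [d], the search from [l] moves on to [l.+1] and the
    second factor vanishes. If [l] reaches [d], it also reaches [b], and [topval_stable] kills the
    first factor. If only [[l.+1,d]] is covered, the gap is [l] itself, and both terms of the first
    factor are 0. *)
Lemma ptval_orth a l b d : (a <= l)%N -> (l < b)%N -> (b <= d)%N -> (d < n)%N ->
  (ptval a b - ptval a l) * (ptval l d - ptval l.+1 d) = 0.
Proof.
move=> al lb bd dn.
have fullI p q k : full p q -> (p <= k)%N -> (k <= q)%N -> (q < n)%N -> supp k.
  move=> /forallP f pk kq qn; have kn : (k < n)%N by lia.
  by apply: (implyP (f (Ordinal kn))); apply/andP.
have [Fld|nF] := boolP (full l d).
  have Fld1 : full l.+1 d.
    by apply/forallP => k; apply/implyP => hk; apply: (fullI l d) => //; lia.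
  rewrite /(ptval l d) /(ptval l.+1 d) Fld Fld1 (@topvalS l d); last lia.
  case: ifP => [r|_]; last by rewrite subrr mulr0.
  have rb : reach l b by apply: reach_le r.
  have -> : ptval a b = ptval a l; last by rewrite subrr mul0r.
  rewrite /ptval (topval_stable (l := l)) //; last by lia.
  congr (if _ then _ else _); apply/forallP/forallP => f k; apply/implyP => hk.
    by apply: (implyP (f k)); lia.
  have [kl|lk] := leqP k l; first by apply: (implyP (f k)); lia.
  by apply: (fullI l d) => //; lia.
rewrite /(ptval l d) (negPf nF) /(ptval l.+1 d); case: ifP => [f1|]; last by rewrite subrr mulr0.
have nl : ~~ supp l.
  apply: contra nF => sl; apply/forallP => k; apply/implyP => hk.
  have [->//|kl] := eqVneq (k : nat) l.
  by apply: (fullI l.+1 d) => //; lia.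
rewrite /ptval !ifF ?subrr ?mul0r //; apply: contraNF nl => f.
  by apply: (fullI _ _ _ f); lia.
by apply: (fullI _ _ _ f); lia.
Qed.

End Points.

(** * Recovering a U-set from its point *)

Section Separation.
Variable n : nat.
Implicit Types (u v : {set gen n}) (al be : Phi1 n).

Lemma lo_hi al : (lo al < hi al)%N.
Proof. exact: (valP al). Qed.

Lemma Phi1_inj al be : lo al = lo be -> hi al = hi be -> al = be.
Proof. by case: al be => [[a b] h] [[c d] h'] /= *; apply: val_inj; rewrite /= -/lo; congr pair. Qed.

(** [lo be] and [hi al] are two common points, so distinct intervals would violate condition (ii).
    Hence intervals of a U-set never cross, and nested ones share no endpoint. *)
Lemma Uset_arcs u al be : is_Uset u -> inr al \in u -> inr be \in u ->
  (lo al <= lo be)%N -> (lo be < hi al)%N -> (hi al <= hi be)%N -> al = be.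
Proof.
case/andP=> _ /forallP/(_ al)/forallP/(_ be)/implyP U au bu h1 h2 h3.
apply/eqP/negPn/negP => ne.
have /U/cards1P[i iE] : [&& inr al \in u, inr be \in u, al != be & overlap al be].
  by apply/and4P; split=> //; rewrite /overlap h1 h3 (ltnW h2).
have h4 := lo_hi al; have h5 := lo_hi be.
have : lo be \in itv al :&: itv be by rewrite !inE; lia.
have : hi al \in itv al :&: itv be by rewrite !inE; lia.
rewrite iE !inE => /eqP e1 /eqP e2; by move: h2; rewrite e1 e2 ltnn.
Qed.

Lemma reach_arc u al : inr al \in u -> reach u (lo al) (hi al).
Proof.
move=> au; apply/reachP => k /andP[h1 h2].
by exists al; rewrite au h1 h2 leqnn.
Qed.

(** An interval of [u] covering the last unit step before [hi al] and starting at [k] or later would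
    be [al] by [Uset_arcs], but [al] starts before [k]. *)
Lemma Nreach_inside u al k : is_Uset u -> inr al \in u ->
  (lo al < k < hi al)%N -> ~~ reach u k (hi al).
Proof.
move=> U au hk; apply/negP => /reachP.
have ln : ((hi al).-1 < n)%N by have := ltn_ord (hi al); lia.
move=> /(_ (Ordinal ln))[/=|be /and4P[bu h1 h2 h3]]; first by lia.
rewrite /= in h2 h3; have e : al = be by apply: (Uset_arcs U) => //; lia.
by move: h1; rewrite -e; lia.
Qed.

(** An interval that starts in [[lo al, hi al)] and covers a step beyond [hi al] would be [al] by
    [Uset_arcs], but [al] ends at [hi al]. *)
Lemma reach_after u al e : is_Uset u -> inr al \in u -> reach u (lo al) e ->
  reach u (hi al) e.
Proof.
move=> U au /reachP r; apply/reachP => k hk.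
have [|be /and4P[bu h1 h2 h3]] := r k; first by have := lo_hi al; lia.
exists be; rewrite bu h2 h3 andbT leqNgt; apply/negP => lt.
have E : al = be by apply: (Uset_arcs U) => //; lia.
by move: h3; rewrite -E; lia.
Qed.

(* An interval [a,b] of u is recognised by: reach a b holds, no element strictly
   between a and b reaches b, and whatever a reaches beyond b, so does b. *)
Lemma reach_sub u v : is_Uset u -> is_Uset v ->
  (forall a b : nat, (a <= b < n)%N -> reach u a b = reach v a b) ->
  forall al, inr al \in u -> inr al \in v.
Proof.
move=> U V E al au; have h := lo_hi al; have hn := ltn_ord (hi al).
have /reachP r : reach v (lo al) (hi al) by rewrite -E ?reach_arc //; lia.
have ln : ((hi al).-1 < n)%N by lia.
(* [be] is an interval of [v] over the last unit step of [al]. By [Nreach_inside], for [u] and then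
   for [v], its left end is not strictly inside [al], nor is [hi al] strictly inside [be]. *)
have [/=|be /and4P[bv h1 h2 h3]] := r (Ordinal ln); first by lia.
rewrite /= in h2 h3; have hbn := ltn_ord (hi be).
have rv : reach v (lo be) (hi al) by apply: reach_le (reach_arc bv); lia.
have le : lo be = lo al.
  apply/eqP; rewrite -val_eqE /=; apply: contraT => ne.
  have := @Nreach_inside u al (lo be) U au; rewrite E; last by lia.
  by rewrite rv => /(_ _)/implyP; lia.
suff he : hi al = hi be by rewrite (Phi1_inj (esym le) he).
apply/eqP; rewrite -val_eqE /=; apply: contraT => ne.
have ru : reach u (lo al) (hi be) by rewrite E -?le ?reach_arc //; have := lo_hi be; lia.
have := reach_after U au ru; rewrite E; last by lia.
have -> : reach v (hi al) (hi be) = false; last by [].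
by apply/negbTE/(Nreach_inside V bv); lia.
Qed.

(** If [i] were covered in [v] only by an interval, this interval would also lie in [u] and contain
    [i], against condition (i). *)
Lemma supp_sub u v : is_Uset u -> (forall k : nat, supp u k = supp v k) ->
  (forall al, (inr al \in u) = (inr al \in v)) ->
  forall i, inl i \in u -> inl i \in v.
Proof.
move=> /andP[/forallP U _] E A i iu.
have : supp u i by apply/existsP; exists i; rewrite eqxx iu.
rewrite E => /existsP[j /andP[/eqP/val_inj -> /orP[//|/existsP[al /andP[av ia]]]]].
have /forallP/(_ al)/implyP := U i.
by rewrite iu A av ia => /(_ isT).
Qed.

(** The zeros among the values determine [full], hence [supp]. On a covered interval, injectivity of
    [x] makes [E_[a,b] = x_a] equivalent to [reach a b]. Reachability yields the intervals of [u],
    and then the support yields its points. *)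
Lemma ptval_inj u v (x : nat -> int) : is_Uset u -> is_Uset v ->
  injective x -> (forall i, x i != 0) ->
  (forall a b : nat, (a <= b < n)%N -> ptval u x a b = ptval v x a b) -> u = v.
Proof.
move=> U V xI x0 E.
have topN0 (w : {set gen n}) a b : (a <= b)%N -> topval w x a b != 0.
  by move=> /(topval_mem w x)[i _ ->].
have fE a b : (a <= b < n)%N -> full u a b = full v a b.
  move=> ab; have := E a b ab; rewrite /ptval.
  have := topN0 u a b; have := topN0 v a b; have -> : (a <= b)%N by lia.
  move=> /(_ isT) v0 /(_ isT) u0.
  by case: ifP => _; case: ifP => _ // e; move: u0 v0; rewrite ?e -?e eqxx.
have full1 (w : {set gen n}) k : (k < n)%N -> full w k k = supp w k.
  move=> kn; apply/forallP/idP => [/(_ (Ordinal kn))/implyP/=|s j].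
    by rewrite leqnn; apply.
  by apply/implyP => jk; have -> : nat_of_ord j = k by lia.
have sE k : supp u k = supp v k.
  have [kn|nk] := ltnP k n; first by rewrite -!full1 ?fE //; lia.
  by apply/existsP/existsP => -[i /andP[/eqP ik _]]; have := ltn_ord i; lia.
have reach_full (w : {set gen n}) a b : (a < b < n)%N -> reach w a b -> full w a b.
  move=> ab /reachP r; apply/forallP => k; apply/implyP => hk.
  (* The point [b] starts no unit step inside [[a,b]]; it is handled as the right end of the last
     one. *)
  have [k' hk' kk] : exists2 k' : 'I_n, (a <= k' < b)%N & (k' <= k <= k'.+1)%N.
    have [kb|bk] := ltnP k b; first by exists k; lia.
    have ln : (b.-1 < n)%N by lia.
    by exists (Ordinal ln) => /=; lia.
  have [al /and4P[aw h1 h2 h3]] := r k' hk'.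
  apply/existsP; exists k; rewrite eqxx; apply/orP; right.
  by apply/existsP; exists al; rewrite aw inE; lia.
have reachE (w : {set gen n}) a b : (a < b)%N -> full w a b ->
    reach w a b = (ptval w x a b == x a).
  move=> ab f; rewrite /ptval f topvalS //; case: ifP => _; first by rewrite eqxx.
  have [i hi ->] := topval_mem w x ab; apply/esym/negbTE/eqP => /xI; lia.
have rE a b : (a <= b < n)%N -> reach u a b = reach v a b.
  move=> ab; have [<-|ne] := eqVneq a b; first by rewrite !reach_refl.
  have lt : (a < b < n)%N by lia.
  have [f|nf] := boolP (full u a b).
    by rewrite !reachE ?E -?fE //; lia.
  have nf' : ~~ full v a b by rewrite -fE.
  by rewrite (contraNF (@reach_full u a b lt) nf) (contraNF (@reach_full v a b lt) nf').
have aE al : (inr al \in u) = (inr al \in v).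
  by apply/idP/idP; apply: reach_sub => // a b ab; rewrite rE.
apply/setP => -[i|al]; last exact: aE.
by apply/idP/idP; apply: supp_sub => // al; rewrite aE.
Qed.

End Separation.

(** * Straightening *)

Section Straightening.
Variable n : nat.
Implicit Types (g h : gen n) (s t : seq (gen n)) (p q r : freeM n).

Definition mono s : freeM n := \prod_(g <- s) var g.

Inductive zspan (D : pred (seq (gen n))) : freeM n -> Prop :=
| zspan0 : zspan D 0
| zspanD p q of zspan D p & zspan D q : zspan D (p + q)
| zspanN p of zspan D p : zspan D (- p)
| zspan_mono s of D s : zspan D (mono s).

Lemma zspanB D p q : zspan D p -> zspan D q -> zspan D (p - q).
Proof. by move=> hp hq; apply: zspanD hp (zspanN hq). Qed.

Lemma zspan_sum D (I : Type) (r : seq I) (P : pred I) F :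
  (forall i, P i -> zspan D (F i)) -> zspan D (\sum_(i <- r | P i) F i).
Proof. by move=> h; elim/big_ind: _ => //; [exact: zspan0 | exact: zspanD]. Qed.

Lemma zspan_mulz D p (c : int) : zspan D p -> zspan D (p *~ c).
Proof.
have pos k : zspan D p -> zspan D (p *+ k).
  by move=> hp; elim: k => [|k IH]; rewrite ?mulr0n ?mulrS; [exact: zspan0 | exact: zspanD].
by case: c => k hp; [exact: pos | rewrite NegzE mulrNz; apply: zspanN; exact: (pos k.+1)].
Qed.

Lemma mono_cat s t : mono (s ++ t) = mono s * mono t.
Proof. by rewrite /mono big_cat. Qed.

Lemma mono1 g : mono [:: g] = var g.
Proof. by rewrite /mono big_seq1. Qed.

Lemma mono2 g h : mono [:: g; h] = var g * var h.
Proof. by rewrite /mono big_cons big_seq1. Qed.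

Lemma zspanM p q : zspan predT p -> zspan predT q -> zspan predT (p * q).
Proof.
move=> hp hq; elim: hp => [|a b _ IHa _ IHb|a _ IH|s _].
- by rewrite mul0r; apply: zspan0.
- by rewrite mulrDl; apply: zspanD.
- by rewrite mulNr; apply: zspanN.
elim: hq => [|a b _ IHa _ IHb|a _ IH|t _].
- by rewrite mulr0; apply: zspan0.
- by rewrite mulrDr; apply: zspanD.
- by rewrite mulrN; apply: zspanN.
by rewrite -mono_cat; apply: zspan_mono.
Qed.

Lemma zspan_all p : zspan predT p.
Proof.
have one : zspan predT 1 by have -> : 1 = mono [::] by [rewrite /mono big_nil]; apply: zspan_mono.
rewrite [p]mpolyE; apply: zspan_sum => m _.
have -> : p@_m *: 'X_[m] = 'X_[m] *~ p@_m :> freeM n.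
  by rewrite -[p@_m in LHS]intz scaler_int.
apply: zspan_mulz; rewrite mpolyXE_id.
elim/big_ind: _ => // [a b|i _]; first exact: zspanM.
elim: (m i) => [|k IH]; rewrite ?expr0 // exprS; apply: zspanM => //.
have -> : 'X_i = mono [:: enum_val i] by rewrite mono1 /var enum_valK.
exact: zspan_mono.
Qed.

(* The summand n makes a single generator lighter than any product of two, so
   that relations may be corrected by linear terms. *)
Definition weight g : nat :=
  n + (if g is inr a then hi a - lo a else 0).

Definition mu s : nat := \sum_(g <- s) weight g.

Lemma mu_cat s t : mu (s ++ t) = (mu s + mu t)%N.
Proof. by rewrite /mu big_cat. Qed.

Lemma mu1 g : mu [:: g] = weight g. Proof. by rewrite /mu big_seq1. Qed.

Lemma mu2 g h : mu [:: g; h] = (weight g + weight h)%N.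
Proof. by rewrite /mu big_cons big_seq1. Qed.

Definition low m := zspan (fun s => mu s < m)%N.

Lemma low_mono m s : (mu s < m)%N -> low m (mono s).
Proof. by move=> h; apply: zspan_mono. Qed.

Lemma low_le m m' p : (m <= m')%N -> low m p -> low m' p.
Proof.
move=> le; elim=> [|a b _ IHa _ IHb|a _ IH|s sm].
- exact: zspan0.
- exact: zspanD.
- exact: zspanN.
by apply: low_mono; apply: leq_trans le.
Qed.

Lemma low_var g : low (2 * n) (var g).
Proof.
rewrite -mono1; apply: low_mono; rewrite mu1 /weight.
case: g => [i|a]; first by have := ltn_ord i; lia.
by have := ltn_ord (hi a); have := lo_hi a; lia.
Qed.

Lemma low_Sij m (i j k l : 'I_n) : (2 * n + (j - i) + (l - k) < m)%N ->
  low m (Sij i j * Sij k l).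
Proof.
move=> lt; rewrite /Sij; case: insubP => [a _ ea|]; last by rewrite mul0r => *; apply: zspan0.
case: insubP => [b _ eb|]; last by rewrite mulr0 => *; apply: zspan0.
rewrite /SI -mono2; apply: low_mono; rewrite mu2 /weight /lo /hi ea eb /=; lia.
Qed.

Lemma low_SS m (i j : 'I_n) : (2 * n < m)%N -> low m (S_ i * S_ j).
Proof. by move=> lt; rewrite /S_ -mono2; apply: low_mono; rewrite mu2 /weight; lia. Qed.

(* K is the ideal of relations, either of M^*(n) or of its deformation. *)
Variable K : freeM n -> Prop.
Hypothesis K0 : K 0.
Hypothesis KD : forall p q, K p -> K q -> K (p + q).
Hypothesis KM : forall p q, K p -> K (q * p).
(** The correction [q] involves only monomials of length at most one. It is zero for the ideal of
    [M n], and a multiple of [N] for the deformation. *)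
Hypothesis Krel : forall r, relM r -> exists2 q, low (2 * n) q & K (r - q).

Let KN p : K p -> K (- p).
Proof. by move=> /(KM (-1)); rewrite mulN1r. Qed.

(** The pairs that a U-set excludes, repetitions included, ordered as in the left-hand sides of the
    relations. *)
Definition bad g h : bool :=
  match g, h with
  | inl i, inl j => i == j
  | inl i, inr a => i \in itv a
  | inr a, inr b => [&& (lo a <= lo b)%N, (lo b <= hi a)%N, (hi a <= hi b)%N
                      & (2 <= #|itv a :&: itv b|)%N]
  | _, _ => false
  end.

(** For [[a,b]] and [[c,d]] in the third family, the product has total length [(b - a) + (d - c)],
    while [S_[a,l] S_[l,d]] has only [d - a], a drop of [b - c > 0]; products of two points have
    length 0. *)
Lemma bad_reduce g h : bad g h ->
  exists2 q, low (mu [:: g; h]) q & K (var g * var h - q).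
Proof.
have base : (2 * n <= mu [:: g; h])%N by rewrite mu2 /weight; lia.
have step r q : relM r -> low (mu [:: g; h]) q -> r = var g * var h - q ->
    exists2 q', low (mu [:: g; h]) q' & K (var g * var h - q').
  move=> rel lq rE; have [q' lq' Kq'] := Krel rel.
  exists (q + q'); first by apply: zspanD => //; apply: low_le lq'.
  by rewrite opprD addrA -rE.
case: g h base step => [i|a] [j|b] //= base step.
- move=> /eqP e; subst j; apply: (step (rel1 i) 0); [exact: RelM1| exact: zspan0|].
  by rewrite subr0.
- move=> ib; apply: (step (rel2 i b) _ (RelM2 ib) _ erefl).
  apply: zspan_sum => j _; apply: low_SS; rewrite mu2 /weight.
  by have := lo_hi b; lia.
case/and4P=> h1 h2 h3 h4; apply: (step (rel3 a b) _ (RelM3 h1 h2 h3 h4) _ erefl).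
have lt : (lo b < hi a)%N.
  rewrite ltn_neqAle h2 andbT; apply: contraTneq h4 => e; rewrite -ltnNge ltnS.
  apply: leq_trans (subset_leq_card (B := [set lo b]) _) _; last by rewrite cards1.
  by apply/subsetP => k; rewrite !inE -val_eqE /= => hk; lia.
have ha := lo_hi a; have hb := lo_hi b.
have mE : mu [:: inr a; inr b] = (2 * n + (hi a - lo a) + (hi b - lo b))%N.
  by rewrite mu2 /weight; lia.
rewrite mE; apply: zspanB; [apply: zspanD|].
- apply: zspan_sum => i _; apply: zspan_sum => j _; apply: low_SS; lia.
- apply: zspan_sum => l; rewrite !inE => hl; apply: low_Sij; lia.
apply: zspan_sum => l; rewrite !inE => hl; apply: zspan_sum => m.
by rewrite !inE => hm; apply: low_Sij; lia.
Qed.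

(** A repeated generator is bad with itself, since an interval of [Phi1 n] has at least two points.
    Otherwise (i) or (ii) fails, and overlapping intervals are taken in the order given by
    [overlap]. *)
Lemma bad_pair s : ~~ (uniq s && is_Uset [set g in s]) ->
  exists g h t, perm_eq s (g :: h :: t) /\ bad g h.
Proof.
have two g h : g \in s -> h \in s -> g != h -> exists t, perm_eq s (g :: h :: t).
  move=> gs hs ne; exists (rem h (rem g s)).
  apply: perm_trans (perm_to_rem gs) _; rewrite perm_cons; apply: perm_to_rem.
  by rewrite (rem_mem _ hs) // eq_sym.
have itv2 (a b : Phi1 n) : (lo a <= lo b)%N -> (lo b < hi a)%N -> (hi a <= hi b)%N ->
    (2 <= #|itv a :&: itv b|)%N.
  move=> h1 h2 h3; have <- : #|[set lo b; hi a]| = 2%N.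
    by rewrite cards2 -val_eqE /= neq_ltn h2.
  apply: subset_leq_card; apply/subsetP => k; rewrite !inE => /orP[] /eqP ->; lia.
rewrite negb_and => /orP[nu|].
  have [g [t st]] : exists g t, perm_eq s (g :: g :: t).
    elim: s nu {two} => [//|x s IH]; rewrite /= negb_and negbK => /orP[xs|/IH[g [t st]]].
      by exists x, (rem x s); rewrite perm_cons perm_to_rem.
    exists g, (x :: t); rewrite -(perm_cons x) in st; apply: perm_trans st _.
    by rewrite (perm_catCA [:: x] [:: g; g] t).
  exists g, g, t; split=> //; case: g {st} => [i|a] //=.
  have h := lo_hi a.
  by rewrite leqnn (ltnW h) itv2 // leqnn.
rewrite negb_and => /orP[|] /forallPn[].
  move=> i /forallPn[a]; rewrite !inE negb_imply negbK => /andP[/andP[si sa] ia].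
  by have [t st] := two _ _ si sa isT; exists (inl i), (inr a), t; rewrite /= inE.
move=> a /forallPn[b]; rewrite !inE negb_imply => /andP[/and4P[sa sb ab ov] c].
have strict (al be : Phi1 n) : (lo al <= lo be)%N -> (lo be <= hi al)%N ->
    (hi al <= hi be)%N -> #|itv al :&: itv be| != 1%N -> (lo be < hi al)%N.
  move=> h1 h2 h3; rewrite ltn_neqAle h2 andbT; apply: contraNneq => e.
  apply/cards1P; exists (lo be); apply/setP => k; rewrite !inE -val_eqE /=.
  by have := lo_hi al; have := lo_hi be; lia.
case/orP: ov => /and3P[h1 h2 h3].
  have [t st] := two _ _ sa sb ab; exists (inr a), (inr b), t; split=> //=.
  by rewrite h1 h2 h3 itv2 // strict.
have ba : inr b != inr a :> gen n by rewrite eq_sym.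
have [t st] := two _ _ sb sa ba; exists (inr b), (inr a), t; split=> //=.
by rewrite h1 h2 h3 itv2 // strict // setIC.
Qed.

Definition umono (u : Uset n) : freeM n := \prod_(g in val u) var g.

Lemma umono_set s (us : uniq s) (U : is_Uset [set g in s]) :
  mono s = umono (Sub [set g in s] U).
Proof.
by rewrite /mono /umono SubK big_uniq //; apply: eq_bigl => g; rewrite inE.
Qed.

Definition reducible_to_Usets p : Prop :=
  exists c : Uset n -> int, K (p - \sum_u umono u *~ c u).

Lemma rtu0 : reducible_to_Usets 0.
Proof. by exists (fun=> 0); rewrite big1 ?subr0 // => u _; rewrite mulr0z. Qed.

Lemma rtuD p q : reducible_to_Usets p -> reducible_to_Usets q ->
  reducible_to_Usets (p + q).
Proof.
move=> [c hc] [d hd]; exists (fun u => c u + d u).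
under eq_bigr do rewrite mulrzDr.
by rewrite big_split /= opprD addrACA; apply: KD.
Qed.

Lemma rtuN p : reducible_to_Usets p -> reducible_to_Usets (- p).
Proof.
move=> [c hc]; exists (fun u => - c u).
under eq_bigr do rewrite mulrNz.
by rewrite sumrN -opprD; apply: KN.
Qed.

Lemma rtuK p q : K (p - q) -> reducible_to_Usets q -> reducible_to_Usets p.
Proof. by move=> pq [c hc]; exists c; have := KD pq hc; rewrite addrA subrK. Qed.

(** Strong induction on [mu]: modulo [K] a bad pair becomes a combination of lighter monomials, and
    [mu] is additive, so the remaining factors preserve the drop. *)
Lemma mono_straighten s : reducible_to_Usets (mono s).
Proof.
have [m sm] := ubnP (mu s); elim: m s sm => // m IH s sm.
have [/andP[us U]|nU] := boolP (uniq s && is_Uset [set g in s]).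
  rewrite (umono_set us U); exists (fun v => (v == Sub [set g in s] U)%:Z).
  rewrite (bigD1 (Sub [set g in s] U)) //= eqxx mulr1z big1 ?addr0 ?subrr // => v.
  by move=> /negPf ->; rewrite mulr0z.
have [g [h [t [st gh]]]] := bad_pair nU.
have [q lq Kq] := bad_reduce gh.
have -> : mono s = mono t * mono [:: g; h].
  by rewrite mulrC -mono_cat /mono; apply: perm_big.
have ms : mu s = (mu [:: g; h] + mu t)%N by rewrite -mu_cat; apply: perm_big.
apply: (@rtuK _ (mono t * q)); first by rewrite -mulrBr mono2; apply: KM.
elim: lq => [|a b _ IHa _ IHb|a _ IHa|s' lt].
- by rewrite mulr0; apply: rtu0.
- by rewrite mulrDr; apply: rtuD.
- by rewrite mulrN; apply: rtuN.
by rewrite -mono_cat; apply: IH; rewrite mu_cat; lia.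
Qed.

Lemma straighten p : reducible_to_Usets p.
Proof.
elim: (zspan_all p) => [|a b _ IHa _ IHb|a _ IHa|s _].
- exact: rtu0.
- exact: rtuD.
- exact: rtuN.
exact: mono_straighten.
Qed.

End Straightening.

(** * Values of the relations and interpolation *)

Lemma sum_ord_itv (R : nmodType) n c b (Q : pred nat) (f : nat -> R) : (b < n)%N ->
  \sum_(i < n | (c <= i <= b)%N && Q i) f i = \sum_(c <= i < b.+1 | Q i) f i.
Proof.
move=> bn; rewrite (@big_nat_widen _ _ _ c b.+1 n) // (@big_nat_widenl _ _ _ c 0) //.
by rewrite big_mkord; apply: eq_bigl => i; rewrite ltnS; case: (Q i); rewrite ?andbF ?andbT //= andbC.
Qed.

Section RelationValues.
Variables (n : nat) (u : {set gen n}) (x : nat -> int).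
Local Notation F := (ptval u x).
Local Notation G := (fun k => F k k).

(* The value of S_[a,b]; it is 0 for a = b, in accordance with the junk value of
   Sij, which lets the sums over I in rel3 run over the whole intersection. *)
Definition sval_itv (a b : nat) : int := \sum_(a <= k < b.+1) F k k - F a b.
Local Notation s := sval_itv.

Lemma sval_itv0 a : s a a = 0.
Proof. by rewrite /sval_itv big_nat1 subrr. Qed.

(** Telescoping [s c d] down to [s b d] splits the left side over [l]. With [X = F a b - F a l],
    [Y = F l d - F l.+1 d] and [T] the sum of the [G j] for [l < j <= b], the summand is
    [(T - X) (G l - Y) - G l T]. Here [X Y = 0] by [ptval_orth], and [ptval_sing] evaluates [G l X]
    and [T Y]. *)
Lemma rel3_val a b c d : (a <= c)%N -> (c <= b)%N -> (b <= d)%N -> (d < n)%N ->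
  s a b * s c d -
    (\sum_(c <= i < b.+1) \sum_(c <= j < b.+1 | (i < j)%N) G i * G j
     + \sum_(c <= l < b.+1) s a l * s l d - \sum_(c <= l < b) s a l * s l.+1 d) =
  - \sum_(c <= l < b) (x l * (F a b - F a l)
      + \sum_(l.+1 <= j < b.+1) x j * (F l d - F l.+1 d)).
Proof.
move=> ac cb bd dn.
have e2 : \sum_(c <= i < b.+1) \sum_(c <= j < b.+1 | (i < j)%N) G i * G j =
          \sum_(c <= l < b) G l * \sum_(l.+1 <= j < b.+1) G j.
  rewrite big_nat_recr //= [X in _ + X]big1_seq ?addr0 => [|j]; last first.
    by rewrite mem_index_iota; lia.
  apply: eq_big_nat => l hl; rewrite mulr_sumr (@big_nat_widenl _ _ _ l.+1 c) //; lia.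
have tele : s a b * s c d = s a b * s b d + \sum_(c <= l < b) s a b * (s l d - s l.+1 d).
  rewrite -mulr_sumr -mulrDr; congr (_ * _).
  under eq_bigr do rewrite -opprB; rewrite sumrN telescope_sumr //; ring.
rewrite e2 tele big_nat_recr //=.
set A := \sum_(c <= l < b) _; set B := \sum_(c <= l < b) _; set C := \sum_(c <= l < b) _.
set D := \sum_(c <= l < b) _.
have -> : s a b * s b d + A - (B + (C + s a b * s b d) - D) = A - B - C + D by ring.
rewrite /A /B /C /D -!sumrN -!big_split /=; apply: eq_big_nat => l hl.
have E1 : s a b = s a l + \sum_(l.+1 <= j < b.+1) G j - (F a b - F a l).
  by rewrite /sval_itv (@big_cat_nat _ _ _ l.+1 a b.+1) /=; [ring | lia..].
have E2 : s l d = s l.+1 d + G l - (F l d - F l.+1 d).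
  by rewrite /sval_itv big_ltn; [ring | lia].
have -> : \sum_(l.+1 <= j < b.+1) x j * (F l d - F l.+1 d) =
          (\sum_(l.+1 <= j < b.+1) G j) * (F l d - F l.+1 d).
  rewrite mulr_suml; apply: eq_big_nat => j hj; rewrite !mulrBr.
  by rewrite !(ptval_sing _ _ (i := j)) //; lia.
have XY : (F a b - F a l) * (F l d - F l.+1 d) = 0 by apply: ptval_orth; lia.
have <- : G l * (F a b - F a l) = x l * (F a b - F a l).
  by rewrite !mulrBr !(ptval_sing _ _ (i := l)) //; lia.
rewrite E1 E2; move: XY; set Y := F l d - _; set X := F a b - _ => XY.
(* The two sides differ by exactly [X * Y]; inserting this zero leaves a ring identity. *)
by rewrite -[LHS]addr0 -[X in _ + X]oppr0 -XY; ring.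
Qed.

End RelationValues.

(** * Evaluation at the points of all U-sets, and interpolation *)

Section Evaluation.
Variables (n : nat) (N : int).
Implicit Types (u : Uset n) (p q r : freeM n).

(** The successor keeps the value at index 0 nonzero, as [ptval_inj] requires. *)
Definition node (k : nat) : int := N * k.+1%:Z.

Definition gen_val u (g : gen n) : int :=
  match g with
  | inl i => ptval (val u) node i i
  | inr al => sval_itv (val u) node (lo al) (hi al)
  end.

Definition ev u : freeM n -> int := meval (fun i => gen_val u (enum_val i)).

HB.instance Definition _ u := GRing.RMorphism.on (ev u).

Lemma ev_var u g : ev u (var g) = gen_val u g.
Proof. by rewrite /ev /var mevalXU enum_rankK. Qed.

Lemma ev_Sij u (i j : 'I_n) : (i <= j)%N -> ev u (Sij i j) = sval_itv (val u) node i j.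
Proof.
rewrite leq_eqVlt /Sij => /orP[/eqP/val_inj ->|lt]; case: insubP => /= [a h e|].
- by rewrite ltnn in h.
- by move=> _; rewrite rmorph0 sval_itv0.
- by rewrite ev_var /= /lo /hi [val a]e.
by rewrite lt.
Qed.

(** The polynomial [q], of degree at most one, is the same for all points; corrections of relations
    can thus be assembled from their values. *)
Definition linval (f : Uset n -> int) : Prop :=
  exists2 q, low (2 * n) q & forall u, f u = ev u q.

Lemma linval0 : linval (fun=> 0).
Proof. by exists 0; [exact: zspan0 | move=> u; rewrite rmorph0]. Qed.

Lemma linvalD f g : linval f -> linval g -> linval (fun u => f u + g u).
Proof.
move=> [p lp fE] [q lq gE]; exists (p + q); first exact: zspanD.
by move=> u; rewrite rmorphD fE gE.
Qed.

Lemma linvalZ c f : linval f -> linval (fun u => c * f u).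
Proof.
move=> [p lp fE]; exists (p *~ c); first exact: zspan_mulz.
by move=> u; rewrite rmorphMz /= fE mulrC -mulrzr intz.
Qed.

Lemma linvalN f : linval f -> linval (fun u => - f u).
Proof.
move=> [p lp fE]; exists (- p); first exact: zspanN.
by move=> u; rewrite rmorphN fE.
Qed.

Lemma linval_sum (s : seq nat) (F : nat -> Uset n -> int) :
  (forall i, i \in s -> linval (F i)) -> linval (fun u => \sum_(i <- s) F i u).
Proof.
elim: s => [|i s IH] h.
  by have [q lq qE] := linval0; exists q => // u; rewrite big_nil -qE.
have hs : linval (fun u => \sum_(j <- s) F j u).
  by apply: IH => j js; apply: h; rewrite inE js orbT.
have [q lq qE] := linvalD (h i (mem_head _ _)) hs.
by exists q => // u; rewrite big_cons qE.
Qed.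

(** This inverts the change of variables: [E_[a,b]] is the sum of the [S_k] minus [S_[a,b]], where
    [Sij] is 0 if [a = b]. *)
Lemma linval_ptval a b : (a <= b)%N -> (b < n)%N ->
  linval (fun u => ptval (val u) node a b).
Proof.
move=> ab bn; have an : (a < n)%N by apply: leq_ltn_trans bn.
pose i := Ordinal an; pose j := Ordinal bn.
exists (\sum_(k < n | (a <= k <= b)%N && predT (k : nat)) S_ k - Sij i j).
  apply: zspanB; first by apply: zspan_sum => k _; apply: low_var.
  by rewrite /Sij; case: insubP => *; [apply: low_var | apply: zspan0].
move=> u; rewrite rmorphB /= ev_Sij // rmorph_sum /=.
under eq_bigr do rewrite ev_var /=.
rewrite (@sum_ord_itv _ _ _ _ predT (fun k => ptval (val u) node k k)) //.
by rewrite /sval_itv /=; ring.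
Qed.

(** The first two families take the values [x_i E_i] and [x_i (E_i - E_[a,b])], the third is given
    by [rel3_val]. All are linear in the [E], and each [x_i] is a multiple of [N]. *)
Lemma relM_val r : relM r ->
  exists2 q, low (2 * n) q & forall u, ev u r = N * ev u q.
Proof.
move=> rel; suff [f [q lq fE] h] : exists2 f, linval f & forall u, ev u r = N * f u.
  by exists q => // u; rewrite h fE.
case: rel => [i|i al ial|al be h1 h2 h3 _].
- exists (fun u => i.+1%:Z * ptval (val u) node i i).
    by apply: linvalZ; apply: linval_ptval.
  move=> u; rewrite /rel1 rmorphXn /= ev_var /= expr2 ptval_sing ?leqnn //.
  by rewrite /node mulrA.
- exists (fun u => i.+1%:Z * (ptval (val u) node i i
                              - ptval (val u) node (lo al) (hi al))).
    apply: linvalZ; apply: linvalD; first exact: linval_ptval.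
    by apply: linvalN; apply: linval_ptval => //; rewrite ltnW ?lo_hi.
  move=> u; rewrite /rel2 rmorphB rmorphM rmorph_sum /= !ev_var /=.
  under eq_bigr do rewrite rmorphM /= !ev_var /=.
  set F := ptval _ _; rewrite -mulr_sumr -mulrBr.
  have -> : sval_itv (val u) node (lo al) (hi al) =
      \sum_(j in itv al | j != i) F j j + F i i - F (lo al) (hi al).
    rewrite /sval_itv -(@sum_ord_itv _ n _ _ predT (fun k => F k k)) //.
    congr (_ - _); rewrite (bigD1 i) /=; last by rewrite inE in ial; rewrite ial.
    by rewrite addrC; congr (_ + _); apply: eq_bigl => j; rewrite inE andbT.
  rewrite inE in ial.
  transitivity (F i i * F i i - F i i * F (lo al) (hi al)); first by ring.
  by rewrite {1 3}/F !ptval_sing ?leqnn // /node -/F; ring.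
have h := lo_hi al; have h' := lo_hi be.
exists (fun u => - \sum_(lo be <= l < hi al)
   (l.+1%:Z * (ptval (val u) node (lo al) (hi al) - ptval (val u) node (lo al) l)
   + \sum_(l.+1 <= j < (hi al).+1)
       j.+1%:Z * (ptval (val u) node l (hi be) - ptval (val u) node l.+1 (hi be)))).
  have hn := ltn_ord (hi be).
  apply: linvalN; apply: linval_sum => l; rewrite mem_index_iota => hl.
  apply: linvalD.
    apply: linvalZ; apply: linvalD; last apply: linvalN; apply: linval_ptval; lia.
  apply: linval_sum => j; rewrite mem_index_iota => hj.
  apply: linvalZ; apply: linvalD; last apply: linvalN; apply: linval_ptval; lia.
move=> u; set F := ptval _ _; set s := sval_itv (val u) node.
have := @rel3_val n (val u) node (lo al) (hi al) (lo be) (hi be) h1 h2 h3 (ltn_ord _).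
rewrite -/F -/s.
have -> : - \sum_(lo be <= l < hi al) (node l * (F (lo al) (hi al) - F (lo al) l)
      + \sum_(l.+1 <= j < (hi al).+1) node j * (F l (hi be) - F l.+1 (hi be))) =
  N * - \sum_(lo be <= l < hi al) (l.+1%:Z * (F (lo al) (hi al) - F (lo al) l)
      + \sum_(l.+1 <= j < (hi al).+1) j.+1%:Z * (F l (hi be) - F l.+1 (hi be))).
  rewrite mulrN mulr_sumr; congr (- _); apply: eq_bigr => l _.
  rewrite [RHS]mulrDr /node [in RHS]mulrA; congr (_ + _); rewrite mulr_sumr.
  by apply: eq_bigr => j _; rewrite mulrA.
move=> <-.
rewrite /rel3 rmorphB rmorphM rmorphB rmorphD !rmorph_sum /= !ev_var /= -/s.
have AB (k : 'I_n) : (k \in itv al :&: itv be) = (lo be <= k <= hi al)%N.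
  by rewrite !inE; lia.
congr (_ - (_ + _ - _)).
- under eq_bigr => i _.
    rewrite rmorph_sum /=; under eq_bigr do rewrite rmorphM /= !ev_var /=.
    under eq_bigl do rewrite AB.
    rewrite (@sum_ord_itv _ n _ _ (fun j => i < j)%N (fun j => F i i * F j j)) //.
    over.
  rewrite -(@sum_ord_itv _ n _ _ predT) //; apply: eq_bigl => i.
  by rewrite AB andbT.
(* The range [[lo be, hi al]] exceeds the index set of [rel3] at most by [lo al] and [hi be], where
   a factor is the zero value of a degenerate interval. *)
- rewrite -(@sum_ord_itv _ n _ _ predT (fun l => s (lo al) l * s l (hi be))) //=.
  rewrite [RHS](bigID (fun l => l \in (itv al :\ lo al) :&: (itv be :\ hi be))) /=.
  rewrite [X in _ = _ + X]big1 ?addr0 => [|l].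
    apply: eq_big => l; first by rewrite !inE; lia.
    by rewrite !inE => hl; rewrite rmorphM /= !ev_Sij //; lia.
  rewrite !inE => hl; have [e|ne] := eqVneq (lo al : nat) l.
    by rewrite -e [s _ (lo al)]sval_itv0 mul0r.
  have -> : nat_of_ord l = hi be by move: hl ne; rewrite -!val_eqE /=; lia.
  by rewrite [s (hi be) _]sval_itv0 mulr0.
(* For [c <= l < b], the index [l] can miss [I] only if [l = a], and [l.+1] only if [l.+1 = d]; the
   extra terms vanish again. *)
set I := (_ :&: _); set a := lo al; set b := hi al; set c := lo be; set d := hi be.
have bS : (b.-1.+1 = b)%N by rewrite prednK // (leq_trans _ h).
rewrite -bS -(@sum_ord_itv _ n _ _ predT (fun l => s a l * s l.+1 d)); last first.
  by apply: leq_ltn_trans (ltn_ord b); rewrite leq_pred.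
rewrite big_mkcond [RHS]big_mkcond; apply: eq_bigr => l _; rewrite andbT.
have -> : (l <= b.-1)%N = (l < b)%N by rewrite -[in RHS]bS ltnS.
case: ifP => lI; last first.
  case: ifP => // hl; have -> : a = l.
    by apply: val_inj; move: lI hl; rewrite !inE -!val_eqE /a /b /c /d /=; lia.
  by rewrite [s l l]sval_itv0 mul0r.
case: ifP => hl; last first.
  rewrite big_pred0 ?rmorph0 // => m; apply/negbTE/negP => /andP[mI /eqP].
  by move: mI lI hl; rewrite !inE /a /b /c /d; lia.
have mn : (l.+1 < n)%N by have := ltn_ord b; lia.
have lE : ev u (Sij a l) = s a l.
  by apply: ev_Sij; move: hl h1; rewrite /a /c; lia.
have [mI|mI] := boolP (Ordinal mn \in I).
  rewrite (big_pred1 (Ordinal mn)) => [|m].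
    by rewrite rmorphM /= lE ev_Sij //=; move: hl h3; rewrite /b /d; lia.
  rewrite /= -(val_eqE m) /=; case: eqP => [e|]; last by rewrite andbF.
  by have -> : m = Ordinal mn by [apply: val_inj]; rewrite mI.
rewrite big_pred0 => [|m]; last first.
  apply/negbTE/negP => /andP[mI' /eqP e]; move: mI.
  by have -> : Ordinal mn = m by [exact: val_inj]; rewrite mI'.
have -> : l.+1 = d.
  have : l.+1 = Ordinal mn by [].
  by move: mI lI hl; rewrite !inE -!val_eqE /a /b /c /d /=; lia.
by rewrite [s d d]sval_itv0 mulr0 rmorph0.
Qed.

Hypothesis N0 : N != 0.

(** If the generators agree at two points, so do all [E_[a,b]], and [ptval_inj] applies. *)
Lemma ev_separates u v : u != v -> exists p, ev u p != ev v p.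
Proof.
move=> ne; have [/existsP[g gne]|] := boolP [exists g, gen_val u g != gen_val v g].
  by exists (var g); rewrite !ev_var.
rewrite negb_exists => /forallP E; case/negP: ne; apply/eqP/val_inj.
have {}E g : gen_val u g = gen_val v g by apply/eqP; have := E g; rewrite negbK.
have Eev p : ev u p = ev v p by apply: meval_eq => i; apply: E.
apply: (@ptval_inj _ _ _ node (valP u) (valP v)).
- by move=> i j /(mulfI N0); case.
- by move=> i; rewrite mulf_neq0.
move=> a b /andP[ab bn]; have an : (a < n)%N by apply: leq_ltn_trans bn.
have Ed k : (k < n)%N -> ptval (val u) node k k = ptval (val v) node k k.
  by move=> kn; apply: (E (inl (Ordinal kn))).
have : ev u (Sij (Ordinal an) (Ordinal bn)) = ev v (Sij (Ordinal an) (Ordinal bn)).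
  exact: Eev.
rewrite !ev_Sij // /sval_itv /=.
rewrite (eq_big_nat _ _ (F2 := fun k => ptval (val v) node k k)) => [|k hk].
  by move/addrI/oppr_inj.
by apply: Ed; lia.
Qed.

(** Lagrange interpolation without normalisation, since the coefficients are integers. *)
Lemma ev_interpolate u : exists2 p, ev u p != 0 & forall v, v != u -> ev v p = 0.
Proof.
have sep v : exists p, v != u -> ev v p != ev u p.
  by have [->|/ev_separates[p]] := eqVneq v u; [exists 0 | exists p].
have [P hP] := fin_all_exists sep.
exists (\prod_(v | v != u) (P v - (ev v (P v))%:MP)).
  rewrite rmorph_prod; apply/prodf_neq0 => v vu.
  by rewrite rmorphB /= /ev mevalC subr_eq0 eq_sym; apply: hP.
move=> v vu; rewrite rmorph_prod (bigD1 v) //=.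
by rewrite rmorphB /= /ev mevalC subrr mul0r.
Qed.

(** Straightening applies to the ideal [K] of polynomials vanishing at all points: there each
    relation agrees with [N] times a linear polynomial. *)
Lemma ev_straighten p : exists c : Uset n -> int,
  forall u, ev u p = \sum_v ev u (umono v) * c v.
Proof.
pose K q := forall u, ev u q = 0.
have [||||c hc] := @straighten n K _ _ _ _ p.
- by move=> u; rewrite rmorph0.
- by move=> q r hq hr u; rewrite rmorphD /= hq hr addr0.
- by move=> q r hq u; rewrite rmorphM /= hq mulr0.
- move=> r /relM_val[q lq rE]; exists (q *~ N); first exact: zspan_mulz.
  by move=> u; rewrite rmorphB rmorphMz /= rE -mulrzr intz mulrC subrr.
exists c => u; have := hc u; rewrite rmorphB rmorph_sum /= => /subr0_eq ->.
by apply: eq_bigr => v _; rewrite rmorphMz /= -mulrzr intz.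
Qed.

(** Monomials and points are both indexed by U-sets, so the table of values [A] is square.
    Straightening the interpolation polynomials gives [C] with [C *m A] diagonal and nonsingular;
    hence [det A] is nonzero, and [c] lies in the left kernel of [A]. *)
Lemma umono_free (c : Uset n -> int) :
  (forall u, \sum_v ev u (umono v) * c v = 0) -> forall v, c v = 0.
Proof.
move=> c0.
have [P P1 P0] := fin_all_exists2 ev_interpolate.
have [B hB] := fin_all_exists (fun u => ev_straighten (P u)).
pose m := #|{: Uset n}|.
pose A := \matrix_(i < m, j < m) ev (enum_val j) (umono (enum_val i)).
pose C := \matrix_(i < m, j < m) B (enum_val i) (enum_val j).
have CA : C *m A = diag_mx (\row_j ev (enum_val j) (P (enum_val j))).
  apply/matrixP => i j; rewrite !mxE.
  transitivity (ev (enum_val j) (P (enum_val i))).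
    rewrite hB [RHS](reindex_onto enum_val enum_rank) /=; last first.
      by move=> v _; rewrite enum_rankK.
    apply: eq_big => k; first by rewrite enum_valK eqxx.
    by move=> _; rewrite !mxE mulrC.
  have [->|ne] := eqVneq i j; first by rewrite mulr1n.
  by rewrite mulrb P0 // (inj_eq enum_val_inj) eq_sym.
have dA : \det A != 0.
  have : \det (C *m A) != 0.
    by rewrite CA det_diag; apply/prodf_neq0 => j _; rewrite mxE.
  by rewrite det_mulmx mulf_eq0 negb_or => /andP[].
pose w := \row_(i < m) c (enum_val i).
have wA : w *m A = 0.
  apply/rowP => j; rewrite !mxE -[RHS](c0 (enum_val j)).
  rewrite [RHS](reindex_onto enum_val enum_rank) /=; last first.
    by move=> v _; rewrite enum_rankK.
  apply: eq_big => k; first by rewrite enum_valK eqxx.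
  by move=> _; rewrite !mxE mulrC.
have w0 : w = 0.
  by apply/eqP; apply: contraNT dA => wn; apply/det0P; exists w.
by move=> v; have /rowP/(_ (enum_rank v)) := w0; rewrite !mxE enum_rankK.
Qed.

End Evaluation.

(** On the points, an element of the ideal equals [N] times some [q]. Straightening [q] gives [d],
    and [umono_free] applied to [c - N d] concludes. *)
Lemma ideal_umono_dvd n (N : int) (c : Uset n -> int) : N != 0 ->
  gen_ideal (@relM n) (\sum_u umono u *~ c u) ->
  exists d : Uset n -> int, forall u, c u = N * d u.
Proof.
move=> N0 h.
have [q qE] : exists q, forall u, ev N u (\sum_u umono u *~ c u) = N * ev N u q.
  elim: h => [|r x y rx _ [q qE]]; first by exists 0 => u; rewrite !rmorph0 mulr0.
  have [q' _ q'E] := relM_val N rx; exists (r * q' + q) => u.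
  by rewrite !rmorphD !rmorphM /= qE q'E; ring.
have [d dE] := ev_straighten N q; exists d => u.
apply/eqP; rewrite -subr_eq0; apply/eqP; move: u.
apply: (umono_free N0) => u.
under eq_bigr do rewrite mulrBr.
rewrite sumrB; apply/eqP; rewrite subr_eq0; apply/eqP.
transitivity (ev N u (\sum_u umono u *~ c u)).
  by rewrite rmorph_sum; apply: eq_bigr => v _; rewrite rmorphMz /= -mulrzr intz.
by rewrite qE dE mulr_sumr; apply: eq_bigr => v _; rewrite mulrCA.
Qed.

(** * Passage to the quotient ring *)

Section Quotient.
Variable n : nat.
Local Open Scope quotient_scope.

Lemma pi_eq0 (p : freeM n) : (\pi_(M n) p == 0) = (p \in @idealM n).
Proof.
have -> : 0 = \pi_(M n) 0 :> M n by rewrite rmorph0.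
by rewrite -[p in RHS]subr0 Quotient.idealrBE.
Qed.

Lemma Smon_pi (u : Uset n) : Smon u = \pi_(M n) (umono u).
Proof. by rewrite /Smon /umono rmorph_prod. Qed.

End Quotient.

Theorem mainTheorem2 (n : nat) (hn : (1 <= n)%N) : is_Zbasis (@Smon n).
Proof.
have piE (c : Uset n -> int) :
    \sum_u Smon u *~ c u = (\pi_(M n) (\sum_u umono u *~ c u))%qT.
  by rewrite rmorph_sum; apply: eq_bigr => u _; rewrite Smon_pi rmorphMz.
split=> [v|c /eqP].
  have [||||c hc] := @straighten n (gen_ideal (@relM n)) _ _ _ _ (repr v).
  - exact: GenIdeal0.
  - by move=> p q hp hq; rewrite -[p]mul1r; apply: gen_ideal_comb.
  - by move=> p q hp; rewrite -[_ * _]addr0; apply: gen_ideal_comb => //; exact: GenIdeal0.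
  (* The relations lie in the ideal itself, so the correction is zero. *)
  - move=> r rr; exists 0; first exact: zspan0.
    by rewrite subr0 -[r]mul1r -[1 * r]addr0; apply: GenIdealD => //; exact: GenIdeal0.
  exists c; rewrite piE -[LHS]reprK; apply/eqP.
  by rewrite -subr_eq0 -rmorphB pi_eq0; apply/boolp.asboolP.
rewrite piE pi_eq0 => /boolp.asboolP h u.
(* With this [N], the coefficient [c u] is a multiple of an integer of larger absolute value, hence
   zero. *)
have [|d dE] := @ideal_umono_dvd n (`|c u| + 1) c _ h; first by lia.
have := dE u; have [->|] := eqVneq (d u) 0; first by rewrite mulr0.
by move=> dn /(congr1 Num.norm); rewrite Num.Theory.normrM; nia.
Qed.
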